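(* Let $f\colon\mathbb{R}^n\to\mathbb{R}^m$ be strictly differentiable at $\bar x\in\mathbb{R}^n$, and let $\vartheta\colon\mathbb{R}^m\to\overline{\mathbb{R}}$ with $f(\bar x)\in\operatorname{dom}\vartheta$ be convex, lower semicontinuous around $f(\bar x)$, and Lipschitz continuous around this point relative to its domain with constant $\ell\ge 0$. If the metric subregularity qualification condition (MSQC) for $\vartheta\circ f$ holds at $\bar x$ with some constant $\kappa\ge 0$, then the composition $\vartheta\circ f$ is lower regular at $\bar x$ and $$\partial(\vartheta\circ f)(\bar x)=\widehat\partial(\vartheta\circ f)(\bar x)=\nabla f(\bar x)^*\partial\vartheta\big(f(\bar x)\big).$$
   Context: $\overline{\mathbb{R}}:=(-\infty,\infty]$, $\operatorname{dom}\varphi:=\{x\mid\varphi(x)<\infty\}$, $\operatorname{epi}\varphi:=\{(x,\alpha)\mid\alpha\ge\varphi(x)\}$; $^*$ denotes the adjoint (transpose). $f$ is strictly differentiable at $\bar x$ with Jacobian $\nabla f(\bar x)$ if $\lim_{x,u\to\bar x,\,x\neq u}\frac{f(x)-f(u)-\nabla f(\bar x)(x-u)}{\|x-u\|}=0$. For $\Omega\subset\mathbb{R}^n$, $\bar x\in\Omega$: the regular normal cone is $\widehat N_\Omega(\bar x):=\{v\mid\limsup_{x\to\bar x,\,x\in\Omega}\frac{\langle v,x-\bar x\rangle}{\|x-\bar x\|}\le 0\}$; the limiting normal cone $N_\Omega(\bar x)$ is the set of all $v$ for which there are $x_k\to\bar x$ with $x_k\in\Omega$ and $v_k\to v$ with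 $v_k\in\widehat N_\Omega(x_k)$. For $\varphi\colon\mathbb{R}^n\to\overline{\mathbb{R}}$, $\bar x\in\operatorname{dom}\varphi$: $\widehat\partial\varphi(\bar x):=\{v\mid(v,-1)\in\widehat N_{\operatorname{epi}\varphi}(\bar x,\varphi(\bar x))\}$ (regular subdifferential) and $\partial\varphi(\bar x):=\{v\mid(v,-1)\in N_{\operatorname{epi}\varphi}(\bar x,\varphi(\bar x))\}$ (limiting subdifferential); for convex functions both are the subdifferential of convex analysis. $\varphi$ is lower regular at $\bar x$ if $\partial\varphi(\bar x)=\widehat\partial\varphi(\bar x)$. $\varphi$ is Lipschitz continuous around $\bar x$ relative to its domain with constant $\ell$ if there is a neighborhood $U$ of $\bar x$ with $|\varphi(x)-\varphi(u)|\le\ell\|x-u\|$ for all $x,u\in U\cap\operatorname{dom}\varphi$. MSQC for $\vartheta\circ f$ at $\bar x$ with constant $\kappa\ge0$: there is a neighborhood $U$ of $\bar x$ such that $\operatorname{dist}(x;\Omega)\le\kappa\,\operatorname{dist}(f(x);\operatorname{dom}\vartheta)$ for all $x\in U$, where $\Omega:=\{x\in\mathbb{R}^n\mid f(x)\in\operatorname{dom}\vartheta\}$. *)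

(* Defs.v *)
From HB Require Import structures.
From mathcomp Require Import all_boot all_order all_algebra.
From mathcomp Require Import all_classical all_reals all_analysis.

Set Implicit Arguments.
Unset Strict Implicit.
Unset Printing Implicit Defensive.

Import Order.TTheory GRing.Theory Num.Theory.
Import numFieldNormedType.Exports.

Local Open Scope classical_set_scope.
Local Open Scope ring_scope.

(* R^n is the space of columns 'cV[R]_n with its library topology. The library
   norm on matrices is the sup norm, hence the Euclidean norm below; both
   induce the same topology.
   Functions with values in (-oo, +oo] are functions into \bar R together with
   the hypothesis that they never take the value -oo. *)

Section Euclidean.
Variables (R : realType) (n : nat).
Implicit Types (u v x : 'cV[R]_n) (A : set 'cV[R]_n).

Definition dot u v : R := \sum_(i < n) u i 0 * v i 0.

Definition enorm u : R := Num.sqrt (dot u u).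

Definition dist x A : \bar R := ereal_inf [set (enorm (x - y))%:E | y in A].

End Euclidean.

(* The pair (x, a) of R^n x R, seen as a vector of R^(n+1). *)
Definition vpair (R : realType) (n : nat) (x : 'cV[R]_n) (a : R) :
  'cV[R]_(n + 1) := col_mx x (const_mx a).

Definition strictly_differentiable_at (R : realType) (n m : nat)
    (f : 'cV[R]_n -> 'cV[R]_m) (xbar : 'cV[R]_n) (J : 'M[R]_(m, n)) : Prop :=
  (fun p : 'cV[R]_n * 'cV[R]_n =>
     (enorm (p.1 - p.2))^-1 *: (f p.1 - f p.2 - J *m (p.1 - p.2)))
    @ within [set p | p.1 != p.2] (nbhs (xbar, xbar)) --> (0 : 'cV[R]_m).

Section NormalCones.
Variables (R : realType) (n : nat).
Implicit Types (Omega : set 'cV[R]_n) (xbar v : 'cV[R]_n).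

Definition regular_normal_cone Omega xbar : set 'cV[R]_n :=
  [set v | (limf_esup
              (fun x : 'cV[R]_n => (dot v (x - xbar) / enorm (x - xbar))%:E)
              (within Omega xbar^') <= 0)%E].

Definition limiting_normal_cone Omega xbar : set 'cV[R]_n :=
  [set v | exists x_ v_ : nat -> 'cV[R]_n,
     [/\ x_ @ \oo --> xbar, v_ @ \oo --> v &
         forall k, Omega (x_ k) /\ regular_normal_cone Omega (x_ k) (v_ k)]].

End NormalCones.

Section ExtendedRealFunctions.
Variables (R : realType) (n : nat).
Implicit Types (phi : 'cV[R]_n -> \bar R) (xbar : 'cV[R]_n).

Definition edom phi : set 'cV[R]_n := [set x | (phi x < +oo)%E].

Definition epigraph phi : set 'cV[R]_(n + 1) :=
  [set z | exists x a, z = vpair x a /\ (phi x <= a%:E)%E].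

(* Both subdifferentials are meant at points where phi is finite. *)
Definition regular_subdifferential phi xbar : set 'cV[R]_n :=
  [set v | regular_normal_cone (epigraph phi)
             (vpair xbar (fine (phi xbar))) (vpair v (-1))].

Definition subdifferential phi xbar : set 'cV[R]_n :=
  [set v | limiting_normal_cone (epigraph phi)
             (vpair xbar (fine (phi xbar))) (vpair v (-1))].

Definition lower_regular phi xbar : Prop :=
  subdifferential phi xbar = regular_subdifferential phi xbar.

Definition econvex phi : Prop :=
  forall (x y : 'cV[R]_n) (t : R), 0 < t -> t < 1 ->
    (phi (t *: x + (1 - t) *: y)%R
       <= t%:E * phi x + (1 - t)%:E * phi y)%E.

Definition lsc_around phi xbar : Prop :=
  \forall x \near xbar, forall a : R, (a%:E < phi x)%E ->
    \forall y \near x, (a%:E < phi y)%E.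

Definition lipschitz_around_rel_dom phi xbar (l : R) : Prop :=
  exists2 U, nbhs xbar U &
    forall x u, (U `&` edom phi) x -> (U `&` edom phi) u ->
      `|fine (phi x) - fine (phi u)| <= l * enorm (x - u).

End ExtendedRealFunctions.

Definition msqc (R : realType) (n m : nat) (theta : 'cV[R]_m -> \bar R)
    (f : 'cV[R]_n -> 'cV[R]_m) (xbar : 'cV[R]_n) (kappa : R) : Prop :=
  exists2 U, nbhs xbar U &
    forall x, U x ->
      (dist x (f @^-1` edom theta) <= kappa%:E * dist (f x) (edom theta))%E.

(* Main.v *)
Require Import Defs.
From mathcomp Require Import all_boot all_order all_algebra.
From mathcomp Require Import all_classical all_reals all_analysis.
From mathcomp Require Import ring lra.

Set Implicit Arguments.
Unset Strict Implicit.
Unset Printing Implicit Defensive.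

Import Order.TTheory GRing.Theory Num.Theory.
Import numFieldNormedType.Exports.

Local Open Scope classical_set_scope.
Local Open Scope ring_scope.

(** The inclusion of J^T d theta (f xbar) in the regular subdifferential follows
    from differentiability: along f the increment of the convex function theta
    is at least <u, f x - f xbar> (regular_subdifferential_chain). Since regular
    subgradients are limiting ones, everything reduces to the inclusion of the
    limiting subdifferential of theta o f in J^T d theta (f xbar).

    Let v be a limiting subgradient, approximated by regular normals (v_k, -c_k)
    to the epigraph of theta o f at points (x_k, a_k). At each x_k the normal
    inequality constrains only points whose image lies in the domain of theta.
    Metric subregularity and the relative Lipschitz property of theta turn it
    into an unconstrained one with an exact penalty (exact_penalty):
    near (x_k, f x_k),
      <v_k, x - x_k> <= c_k (theta y - theta (f x_k)) + C |f x - y|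
                        + o(|x - x_k|)
    with C independent of k. Near xbar strict differentiability allows f x to
    be replaced by f x_k + J (x - x_k) at the cost of a small multiple of
    |x - x_k|; now both sides are convex, so the inequality holds for all x
    and y (penalized_inequality), and in the limit
      <v, h> <= theta y - theta (f xbar) + C |J h - (y - f xbar)|
    for all h and y (limiting_penalized_inequality).

    This is a convex problem: a finite-dimensional Hahn-Banach argument
    (linear_minorant) yields u with J^T u = v that is a subgradient of theta at
    f xbar (subgradient_of_limiting). For the convex function theta the limiting
    subgradients are exactly these global ones (subdifferential_convexE). *)

(** * Euclidean geometry of R^n and R^(n+1) *)

Section EuclideanSpace.
Variable R : realType.

Section Vectors.
Variable n : nat.
Implicit Types (u v w x y : 'cV[R]_n) (a : R).

Lemma dotC u v : dot u v = dot v u.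
Proof. by apply: eq_bigr => i _; rewrite mulrC. Qed.

Lemma dotDr u v w : dot u (v + w) = dot u v + dot u w.
Proof. by rewrite -big_split; apply: eq_bigr => i _; rewrite !mxE mulrDr. Qed.

Lemma dotZr a u v : dot u (a *: v) = a * dot u v.
Proof. by rewrite mulr_sumr; apply: eq_bigr => i _; rewrite !mxE mulrCA. Qed.

Lemma dotNr u v : dot u (- v) = - dot u v.
Proof. by rewrite -scaleN1r dotZr mulN1r. Qed.

Lemma dotBr u v w : dot u (v - w) = dot u v - dot u w.
Proof. by rewrite dotDr dotNr. Qed.

Lemma dotDl u v w : dot (u + v) w = dot u w + dot v w.
Proof. by rewrite !(dotC _ w) dotDr. Qed.

Lemma dotZl a u v : dot (a *: u) v = a * dot u v.
Proof. by rewrite !(dotC _ v) dotZr. Qed.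

Lemma dotBl u v w : dot (u - v) w = dot u w - dot v w.
Proof. by rewrite !(dotC _ w) dotBr. Qed.

Lemma dot0r u : dot u 0 = 0.
Proof. by rewrite -(scale0r 0) dotZr mul0r. Qed.

Lemma dot_ge0 u : 0 <= dot u u.
Proof. by apply: sumr_ge0 => i _; exact: sqr_ge0. Qed.

Lemma dot_eq0 u : dot u u = 0 -> u = 0.
Proof.
move=> /eqP; rewrite psumr_eq0 => [/allP u0|i _]; last exact: sqr_ge0.
apply/matrixP => i j; rewrite ord1 mxE.
by have := u0 i (mem_index_enum i); rewrite /= mulf_eq0 orbb => /eqP.
Qed.

Lemma dot_delta u k : dot u (delta_mx k 0) = u k 0.
Proof.
rewrite /dot (bigD1 k)//= mxE !eqxx mulr1 big1 ?addr0// => i /negPf ik.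
by rewrite mxE ik mulr0.
Qed.

Lemma enorm_ge0 u : 0 <= enorm u.
Proof. exact: sqrtr_ge0. Qed.

Lemma sqr_enorm u : enorm u ^+ 2 = dot u u.
Proof. by rewrite sqr_sqrtr// dot_ge0. Qed.

Lemma enorm0 : enorm (0 : 'cV[R]_n) = 0.
Proof. by rewrite /enorm dot0r sqrtr0. Qed.

Lemma enorm_eq0 u : enorm u = 0 -> u = 0.
Proof. by move=> u0; apply: dot_eq0; rewrite -sqr_enorm u0 expr0n. Qed.

Lemma enorm_gt0 u : u != 0 -> 0 < enorm u.
Proof.
move=> u0; rewrite lt_neqAle enorm_ge0 andbT eq_sym.
by apply: contra u0 => /eqP/enorm_eq0 ->.
Qed.

Lemma enormZ a u : enorm (a *: u) = `|a| * enorm u.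
Proof.
rewrite /enorm dotZr dotZl mulrA -expr2 sqrtrM ?sqr_ge0//.
by rewrite sqrtr_sqr.
Qed.

Lemma enormN u : enorm (- u) = enorm u.
Proof. by rewrite -scaleN1r enormZ normrN1 mul1r. Qed.

Lemma enormBC u v : enorm (u - v) = enorm (v - u).
Proof. by rewrite -enormN opprB. Qed.

(** For nonzero vectors, expand the square of |v| u - |u| v. *)
Lemma cauchy_schwarz u v : dot u v <= enorm u * enorm v.
Proof.
have [->|u0] := eqVneq u 0; first by rewrite dotC dot0r enorm0 mul0r.
have [->|v0] := eqVneq v 0; first by rewrite dot0r enorm0 mulr0.
have := dot_ge0 (enorm v *: u - enorm u *: v).
rewrite !(dotBl, dotBr, dotZl, dotZr) -!sqr_enorm (dotC v u).
have := mulr_gt0 (enorm_gt0 u0) (enorm_gt0 v0).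
set a := enorm u; set b := enorm v => ab h.
rewrite -(ler_pM2l ab); nra.
Qed.

Lemma enormD u v : enorm (u + v) <= enorm u + enorm v.
Proof.
rewrite -(@ler_pXn2r _ 2)// ?nnegrE ?addr_ge0 ?enorm_ge0//.
rewrite sqr_enorm dotDl !dotDr (dotC v u) -!sqr_enorm.
have := cauchy_schwarz u v; nra.
Qed.

Lemma enorm_triangle v u w : enorm (u - w) <= enorm (u - v) + enorm (v - w).
Proof. by rewrite -[in leLHS](subrK v u) -addrA enormD. Qed.

Lemma ler_abs_enorm u i : `|u i 0| <= enorm u.
Proof.
rewrite -(sqrtr_sqr (u i 0)) ler_wsqrtr// /dot (bigD1 i)//= expr2 lerDl.
by apply: sumr_ge0 => j _; exact: sqr_ge0.
Qed.

Lemma enorm_le_sum u : enorm u <= \sum_(i < n) `|u i 0|.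
Proof.
rewrite -(@ler_pXn2r _ 2)// ?nnegrE ?enorm_ge0 ?sumr_ge0//.
rewrite sqr_enorm expr2 mulr_suml; apply: ler_sum => i _.
rewrite -expr2 -real_normK ?num_real// expr2.
by rewrite ler_wpM2l// (bigD1 i)//= lerDl sumr_ge0.
Qed.

Lemma mx_norm_le_enorm u : `|u| <= enorm u.
Proof.
have [->|u0] := eqVneq u 0; first by rewrite normr0 enorm_ge0.
have : mx_norm u != 0 by apply: contra u0 => /eqP/mx_norm_eq0 ->.
move=> /mx_norm_neq0[[i j]] /= un; rewrite [`|u|]un ord1.
exact: ler_abs_enorm.
Qed.

Lemma enorm_le_mx_norm u : enorm u <= n%:R * `|u|.
Proof.
apply: le_trans (enorm_le_sum u) _.
rewrite mulr_natl -[X in _ *+ X]card_ord -sumr_const.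
apply: ler_sum => i _; rewrite [`|u|]mx_normrE.
exact: (le_bigmax_cond _ (fun k : 'I_n * 'I_1 => `|u k.1 k.2|) (j := (i, 0))).
Qed.

(** The topology of matrices is that of the sup norm, which is equivalent to the
    Euclidean norm, so all topological hypotheses can be read with enorm. *)
Lemma nbhs_enormP x (A : set 'cV[R]_n) :
  nbhs x A <-> exists2 r, 0 < r & forall y, enorm (y - x) < r -> A y.
Proof.
split=> [/nbhs_normP[r /= r0 rA]|[r r0 rA]].
  exists r => // y yx; apply: rA; rewrite /= distrC.
  exact: le_lt_trans (mx_norm_le_enorm _) yx.
apply: (proj2 (nbhs_normP x A)); exists (r / n.+1%:R).
  by rewrite /= divr_gt0.
move=> y /= yx; apply: rA; rewrite enormBC.
apply: le_lt_trans (enorm_le_mx_norm _) _.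
rewrite ltr_pdivlMr// in yx; apply: le_lt_trans yx.
by rewrite mulrC ler_wpM2l// ler_nat.
Qed.

Lemma cvg_enormP (x_ : nat -> 'cV[R]_n) x :
  x_ @ \oo --> x <->
  forall e, 0 < e -> \forall k \near \oo, enorm (x_ k - x) < e.
Proof.
split=> [xx e e0|xx A /nbhs_enormP[r r0 rA]].
  by apply: (xx [set y | enorm (y - x) < e]); apply/nbhs_enormP; exists e.
by apply: filterS (xx r r0) => k; exact: rA.
Qed.

End Vectors.

Lemma dot_mulmx m n (J : 'M[R]_(m, n)) u h :
  dot u (J *m h) = dot (J^T *m u) h.
Proof.
have dotE k (a b : 'cV[R]_k) : dot a b = (a^T *m b) 0 0.
  by rewrite mxE; apply: eq_bigr => i _; rewrite mxE.
by rewrite !dotE trmx_mul trmxK mulmxA.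
Qed.

(** The entries of J h are scalar products with the rows of J, so the sum of
    the Euclidean norms of the rows is an admissible bound. *)
Lemma enorm_mulmx_bounded m n (J : 'M[R]_(m, n)) :
  exists2 K, 0 <= K & forall h, enorm (J *m h) <= K * enorm h.
Proof.
exists (\sum_i enorm (row i J)^T).
  by apply: sumr_ge0 => i _; exact: enorm_ge0.
move=> h; apply: le_trans (enorm_le_sum _) _; rewrite mulr_suml.
have le_dot i (g : 'cV[R]_n) : (J *m g) i 0 <= enorm (row i J)^T * enorm g.
  apply: le_trans (cauchy_schwarz _ _); rewrite mxE /dot.
  by apply: ler_sum => j _; rewrite !mxE.
apply: ler_sum => i _; rewrite ler_norml lerNl le_dot andbT.
by have := le_dot i (- h); rewrite mulmxN mxE enormN.
Qed.

Section Pairs.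
Variable n : nat.
Implicit Types (x v : 'cV[R]_n) (a b : R).

Lemma vpairB x y a b : vpair x a - vpair y b = vpair (x - y) (a - b).
Proof.
rewrite /vpair opp_col_mx add_col_mx; congr col_mx.
by apply/matrixP => i j; rewrite !mxE.
Qed.

Lemma dot_vpair v b x a : dot (vpair v b) (vpair x a) = dot v x + b * a.
Proof.
rewrite /dot big_split_ord big_ord1; congr (_ + _); last first.
  by rewrite !col_mxEd !mxE.
by apply: eq_bigr => i _; rewrite !col_mxEu.
Qed.

Lemma sqr_enorm_vpair x a : enorm (vpair x a) ^+ 2 = enorm x ^+ 2 + a ^+ 2.
Proof. by rewrite !sqr_enorm dot_vpair. Qed.

Lemma enorm_vpair_le x a : enorm (vpair x a) <= enorm x + `|a|.
Proof.
rewrite -(@ler_pXn2r _ 2)// ?nnegrE ?addr_ge0 ?enorm_ge0//.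
rewrite sqr_enorm_vpair sqrrD real_normK ?num_real//.
have := mulr_ge0 (enorm_ge0 x) (normr_ge0 a); lra.
Qed.

Lemma enorm_le_vpair x a : enorm x <= enorm (vpair x a).
Proof.
rewrite -(@ler_pXn2r _ 2)// ?nnegrE ?enorm_ge0//.
by rewrite sqr_enorm_vpair lerDl sqr_ge0.
Qed.

Lemma abs_le_vpair x a : `|a| <= enorm (vpair x a).
Proof.
rewrite -(@ler_pXn2r _ 2)// ?nnegrE ?enorm_ge0//.
by rewrite sqr_enorm_vpair real_normK ?num_real// lerDr sqr_ge0.
Qed.

Lemma vpair_surj (z : 'cV[R]_(n + 1)) : exists x a, z = vpair x a.
Proof.
exists (usubmx z), (dsubmx z 0 0); rewrite -[LHS]vsubmxK; congr col_mx.
by apply/matrixP => i j; rewrite !ord1 !mxE.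
Qed.

End Pairs.
End EuclideanSpace.

(** * Linear minorants of convex functions *)

Section ConvexMinorant.
Variable R : realType.

(** A relation between points and heights stands for an extended-real function
    given by points of its epigraph: an infimum over auxiliary variables then
    becomes an existential, and the infimum itself need not be formed. *)
Definition convex_graph (V : lmodType R) (E : V -> R -> Prop) : Prop :=
  forall z z' r r' t, 0 < t -> t < 1 -> E z r -> E z' r' ->
    E (t *: z + (1 - t) *: z') (t * r + (1 - t) * r').

(** The one-dimensional step of the Hahn-Banach theorem. The slope a along e
    must lie above all (phi w - r) / s with E (w - s e) r and below all
    (r - phi w) / t with E (w + t e) r, where s, t > 0. The segment joining two
    such points of E crosses W, where phi minorizes E, so every lower bound is
    at most every upper bound and the supremum of the lower ones works. *)
Lemma extend_minorant_one_dim (V : lmodType R) (E : V -> R -> Prop)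
    (W : set V) (phi : V -> R) (e : V) :
  convex_graph E -> (forall z, exists r, E z r) ->
  W 0 ->
  (forall t w w', W w -> W w' -> W (t *: w + (1 - t) *: w') /\
     phi (t *: w + (1 - t) *: w') = t * phi w + (1 - t) * phi w') ->
  (forall w r, W w -> E w r -> phi w <= r) ->
  exists a, forall w t r, W w -> E (w + t *: e) r -> phi w + t * a <= r.
Proof.
move=> Econv Etot W0 Wconv phi_le.
pose A := [set a | exists s w r,
  [/\ 0 < s, W w, E (w - s *: e) r & a = (phi w - r) / s]].
have A_le t w' r' : 0 < t -> W w' -> E (w' + t *: e) r' ->
    ubound A ((r' - phi w') / t).
  move=> t0 Ww' Er' _ [s [w [r [s0 Ww Er ->]]]].
  have st0 : 0 < s + t by rewrite addr_gt0.
  (* the weight for which the components along e cancel *)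
  pose c := t / (s + t).
  have c0 : 0 < c by rewrite divr_gt0.
  have c1 : c < 1 by rewrite ltr_pdivrMr// mul1r ltrDr.
  have cE : (1 - c) * t = c * s by rewrite /c; field; rewrite gt_eqF.
  have [Wc phic] := Wconv c _ _ Ww Ww'.
  have := Econv _ _ _ _ c c0 c1 Er Er'.
  rewrite scalerBr scalerDr !scalerA cE addrACA addNr addr0 => /(phi_le _ _ Wc).
  rewrite phic => le_c.
  rewrite ler_pdivrMr// mulrAC ler_pdivlMr//.
  rewrite -(ler_pM2l c0); have := ler_wpM2l (ltW t0) le_c.
  have : (1 - c) * t * (r' - phi w') = c * s * (r' - phi w') by rewrite cE.
  lra.
have A_sup : has_sup A.
  split; last first.
    have [r Er] := Etot (0 + 1 *: e).
    by exists ((r - phi 0) / 1); exact: A_le Er.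
  have [r Er] := Etot (0 - 1 *: e).
  by exists ((phi 0 - r) / 1); exists 1, 0, r.
exists (sup A) => w t r Ww Er.
have [t0|t0|t0] := ltgtP t 0.
- have : A ((phi w - r) / - t).
    by exists (- t), w, r; split; rewrite ?oppr_gt0// scaleNr opprK.
  by move=> /(sup_upper_bound A_sup); rewrite ler_pdivrMr ?oppr_gt0//; lra.
- have : sup A <= (r - phi w) / t.
    by apply: ge_sup (A_le t w r t0 Ww Er); case: A_sup.
  by rewrite ler_pdivlMr//; lra.
- rewrite t0 scale0r addr0 in Er.
  by rewrite t0 mul0r addr0; exact: phi_le.
Qed.

(** Hahn-Banach in R^m: the zero functional minorizes E on {0}, and is extended
    one coordinate at a time. *)
Lemma linear_minorant m (E : 'cV[R]_m -> R -> Prop) :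
  convex_graph E -> (forall z, exists r, E z r) ->
  (forall r, E 0 r -> 0 <= r) ->
  exists u, forall z r, E z r -> dot u z <= r.
Proof.
move=> Econv Etot E0.
(* the span of the first k coordinate vectors *)
pose W k := [set z : 'cV[R]_m | forall i : 'I_m, (k <= i)%N -> z i 0 = 0].
suff /(_ m) [u uE] : forall k,
    exists u, forall z r, W k z -> E z r -> dot u z <= r.
  by exists u => z r; apply: uE => i; rewrite leqNgt ltn_ord.
elim=> [|k [u uE]].
  exists 0 => z r Wz Ez; have z0 : z = 0.
    by apply/matrixP => i j; rewrite ord1 mxE Wz.
  by rewrite z0 dot0r; apply: E0; rewrite -z0.
have [mk|km] := leqP m k.
  exists u => z r Wz; apply: uE => i ki.
  by have := ltn_ord i; rewrite ltnNge (leq_trans mk ki).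
pose ik := Ordinal km.
pose e : 'cV[R]_m := delta_mx ik 0.
have [|t w w' Ww Ww'|a aE] := extend_minorant_one_dim
    (W := W k) (phi := dot u) e Econv Etot _ _ uE.
- by move=> i _; rewrite mxE.
- split; last by rewrite dotDr !dotZr.
  by move=> i ki; rewrite !mxE Ww// Ww'// !mulr0 addr0.
exists (u + (a - u ik 0) *: e) => z r Wz Ez.
pose w := z - z ik 0 *: e.
have Ww : W k w.
  move=> i; rewrite leq_eqVlt !mxE eqxx andbT => /orP[/eqP ki|ki].
    have -> : i = ik by apply: val_inj.
    by rewrite eqxx mulr1 subrr.
  by rewrite (Wz i)// -val_eqE /= gtn_eqF// mulr0 subrr.
have zE : z = w + z ik 0 *: e by rewrite subrK.
rewrite zE in Ez; have := aE _ _ _ Ww Ez.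
rewrite /w dotBr dotZr dot_delta dotDl dotZl (dotC e) dot_delta; lra.
Qed.

End ConvexMinorant.

(** * Normals and regularity conditions in terms of the Euclidean norm *)

Section Unfolding.
Variable R : realType.

Lemma regular_normal_coneP n (A : set 'cV[R]_n) x v :
  regular_normal_cone A x v <->
  forall e, 0 < e -> exists2 d, 0 < d &
    forall y, A y -> enorm (y - x) < d -> dot v (y - x) <= e * enorm (y - x).
Proof.
split=> [vN e e0|vN].
  have /ereal_inf_lt[_ [V VF <-] Ve] :
      (limf_esup (fun y : 'cV[R]_n => (dot v (y - x) / enorm (y - x))%:E)
         (within A x^') < e%:E)%E by apply: le_lt_trans vN _; rewrite lte_fin.
  have /nbhs_enormP[d d0 dV] :
    nbhs x [set y : 'cV[R]_n | y != x -> A y -> V y] by exact: VF.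
  exists d => // y Ay yd; have [->|yx] := eqVneq y x.
    by rewrite subrr dot0r enorm0 mulr0.
  have y0 : 0 < enorm (y - x) by rewrite enorm_gt0// subr_eq0.
  rewrite -ler_pdivrMr// -lee_fin; apply: le_trans (ltW Ve).
  by apply: ereal_sup_ubound; exists y => //; exact: dV.
apply/lee_addgt0Pr => e e0; rewrite add0e.
have [d d0 dA] := vN e e0.
apply: (@le_trans _ _ (ereal_sup
    ((fun y : 'cV[R]_n => (dot v (y - x) / enorm (y - x))%:E) @`
      [set y : 'cV[R]_n | A y /\ y != x /\ enorm (y - x) < d]))).
  apply: ereal_inf_lbound; eexists; last by [].
  by apply/nbhs_enormP; exists d.
apply: ge_ereal_sup => _ [y [Ay [yx yd]] <-].
by rewrite lee_fin ler_pdivrMr ?dA// enorm_gt0// subr_eq0.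
Qed.

Lemma strictly_differentiable_atP n m (f : 'cV[R]_n -> 'cV[R]_m) x0 J :
  strictly_differentiable_at f x0 J ->
  forall e, 0 < e -> exists2 d, 0 < d &
    forall x u, enorm (x - x0) < d -> enorm (u - x0) < d ->
      enorm (f x - f u - J *m (x - u)) <= e * enorm (x - u).
Proof.
move=> fJ e e0.
have /fJ : nbhs (0 : 'cV[R]_m) [set z : 'cV[R]_m | enorm z < e].
  by apply/nbhs_enormP; exists e => // y; rewrite subr0.
move=> [[P Q] /= [/nbhs_enormP[d d0 dP] /nbhs_enormP[d' d'0 dQ]] PQ].
exists (Num.min d d'); first by rewrite lt_min d0.
move=> x u; rewrite !lt_min => /andP[xd _] /andP[_ ud].
have [->|xu] := eqVneq x u; first by rewrite !subrr mulmx0 subr0 !enorm0 mulr0.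
have xu0 : 0 < enorm (x - u) by rewrite enorm_gt0// subr_eq0.
have := PQ (x, u) (conj (dP _ xd) (dQ _ ud)) xu.
rewrite /= enormZ ger0_norm ?invr_ge0 ?enorm_ge0//.
by rewrite mulrC ltr_pdivrMr// => /ltW.
Qed.

(** The distance to the domain of the composition is an infimum that need not be
    attained; kappa + 1 leaves the room to choose a point of that domain. *)
Lemma msqc_error_bound n m (theta : 'cV[R]_m -> \bar R)
    (f : 'cV[R]_n -> 'cV[R]_m) x0 kappa :
  0 <= kappa -> msqc theta f x0 kappa ->
  exists2 d, 0 < d & forall x y, enorm (x - x0) < d -> edom theta y ->
    exists2 x', edom theta (f x') &
    enorm (x - x') <= (kappa + 1) * enorm (f x - y).
Proof.
move=> kappa0 [U /nbhs_enormP[d d0 dU] fU]; exists d => // x y xd ydom.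
have [fxy|fxy] := eqVneq (f x) y.
  by exists x; rewrite ?fxy// !subrr !enorm0 mulr0.
have /ereal_inf_lt[_ [x' x'dom <-]] :
    (dist x (f @^-1` edom theta) < ((kappa + 1) * enorm (f x - y))%:E)%E.
  apply: le_lt_trans (fU _ (dU _ xd)) _.
  apply: (@le_lt_trans _ _ (kappa%:E * (enorm (f x - y))%:E)%E).
    apply: lee_wpmul2l; rewrite ?lee_fin//.
    by apply: ereal_inf_lbound; exists y.
  by rewrite -EFinM lte_fin mulrDl mul1r ltrDl enorm_gt0// subr_eq0.
by rewrite lte_fin => /ltW; exists x'.
Qed.

Lemma cvg_vpairP n (z_ : nat -> 'cV[R]_(n + 1)) x a :
  z_ @ \oo --> vpair x a ->
  exists x_ a_, [/\ forall k, z_ k = vpair (x_ k) (a_ k),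
    x_ @ \oo --> x & a_ @ \oo --> a].
Proof.
move=> /cvg_enormP zz.
have [x_ /choice[a_ zE]] := choice (fun k => vpair_surj (z_ k)).
exists x_, a_; split => //.
  apply/cvg_enormP => e /zz; apply: filterS => k.
  by rewrite zE vpairB; apply: le_lt_trans; exact: enorm_le_vpair.
apply/cvgrPdist_lt => e /zz; apply: filterS => k.
by rewrite zE vpairB distrC; apply: le_lt_trans; exact: abs_le_vpair.
Qed.

End Unfolding.

(** * Normals to convex sets and subgradients of convex functions *)

Section ConvexSubgradients.
Variable R : realType.

Lemma regular_normal_of_support n (A : set 'cV[R]_n) x v :
  (forall y, A y -> dot v (y - x) <= 0) -> regular_normal_cone A x v.
Proof.
move=> vA; apply/regular_normal_coneP => e e0; exists 1 => // y /vA vy _.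
by apply: le_trans vy _; rewrite mulr_ge0 ?enorm_ge0// ltW.
Qed.

Lemma regular_normal_limiting n (A : set 'cV[R]_n) x v :
  A x -> regular_normal_cone A x v -> limiting_normal_cone A x v.
Proof. by exists (fun=> x), (fun=> v); split => //; exact: cvg_cst. Qed.

Lemma convex_combB (V : lmodType R) (x y : V) t :
  t *: y + (1 - t) *: x - x = t *: (y - x).
Proof.
by rewrite scalerBl scale1r scalerBr -addrA [x - _ - x]addrAC subrr add0r.
Qed.

Lemma small_step (d s : R) : 0 < d -> 0 <= s ->
  exists t, [/\ 0 < t, t < 1 & t * s < d].
Proof.
move=> d0 s0; have ds0 : 0 < d + s + 1 by lra.
exists (d / (d + s + 1)); split; first by rewrite divr_gt0.
  by rewrite ltr_pdivrMr//; lra.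
by rewrite mulrAC ltr_pdivrMr// ltr_pM2l//; lra.
Qed.

(** For a set that is star-shaped at x, the local inequality of a regular normal
    applies to a point close to x on the segment towards y, and is homogeneous
    along that segment. *)
Lemma regular_normal_convex n (A : set 'cV[R]_n) x v :
  (forall y t, A y -> 0 < t -> t < 1 -> A (t *: y + (1 - t) *: x)) ->
  regular_normal_cone A x v -> forall y, A y -> dot v (y - x) <= 0.
Proof.
move=> Astar /regular_normal_coneP vN y Ay.
apply/ler_addgt0Pr => e e0; rewrite add0r.
have S0 : 0 < 1 + enorm (y - x) by rewrite ltr_pwDl ?enorm_ge0.
have [d d0 dA] := vN _ (divr_gt0 e0 S0).
have [t [t0 t1 td]] := small_step d0 (enorm_ge0 (y - x)).
have := dA _ (Astar _ _ Ay t0 t1).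
rewrite convex_combB enormZ dotZr gtr0_norm// => /(_ td).
rewrite mulrCA ler_pM2l// => /le_trans; apply.
rewrite mulrAC ler_pdivrMr// ler_pM2l//; lra.
Qed.

Lemma cvg_dot n (u_ x_ : nat -> 'cV[R]_n) u x :
  u_ @ \oo --> u -> x_ @ \oo --> x ->
  (fun k => dot (u_ k) (x_ k)) @ \oo --> dot u x.
Proof.
have cvg_coord (z_ : nat -> 'cV[R]_n) (z : 'cV[R]_n) i : z_ @ \oo --> z ->
    (fun k => z_ k i 0) @ \oo --> z i 0.
  move=> /cvg_enormP zz; apply/cvgrPdist_lt => e /zz; apply: filterS => k.
  rewrite distrC; apply: le_lt_trans.
  by have := ler_abs_enorm (z_ k - z) i; rewrite !mxE.
move=> uu xx; rewrite /dot.
apply: cvg_big => [|i _]; first exact: add_continuous.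
by apply: cvgM; exact: cvg_coord.
Qed.

Lemma cvg_enorm n (x_ : nat -> 'cV[R]_n) (x : 'cV[R]_n) :
  x_ @ \oo --> x -> (fun k => enorm (x_ k - x)) @ \oo --> (0 : R).
Proof.
move=> /cvg_enormP xx; apply/cvgrPdist_lt => e /xx; apply: filterS => k.
by rewrite sub0r normrN ger0_norm ?enorm_ge0.
Qed.

Variables (m : nat) (theta : 'cV[R]_m -> \bar R).

(** The subgradients of convex analysis, tested on points of the epigraph
    so that infinite values of theta need no separate treatment. *)
Definition convex_subgradient y0 u := forall y b, (theta y <= b%:E)%E ->
  dot u (y - y0) <= b - fine (theta y0).

Lemma econvex_le y y' b b' t : econvex theta -> 0 < t -> t < 1 ->
  (theta y <= b%:E -> theta y' <= b'%:E ->
   theta (t *: y + (1 - t) *: y')%R <= (t * b + (1 - t) * b')%:E)%E.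
Proof.
move=> cvx t0 t1 yb y'b'; apply: le_trans (cvx _ _ _ t0 t1) _.
rewrite [leRHS]EFinD !EFinM; apply: leeD; apply: lee_wpmul2l => //.
  by rewrite lee_fin ltW.
by rewrite lee_fin subr_ge0 ltW.
Qed.

Lemma edom_fine y : (forall y, (-oo < theta y)%E) -> edom theta y ->
  theta y = (fine (theta y))%:E.
Proof. by move=> /(_ y) yN yy; rewrite fineK// fin_numE -ltNye yN -ltey. Qed.

Lemma epi_edom y b : (theta y <= b%:E)%E -> edom theta y.
Proof. by move=> yb; apply: le_lt_trans yb (ltry b). Qed.

Lemma epigraph_convex z z' t : econvex theta -> 0 < t -> t < 1 ->
  epigraph theta z -> epigraph theta z' ->
  epigraph theta (t *: z + (1 - t) *: z').
Proof.
move=> cvx t0 t1 [y [b [-> yb]]] [y' [b' [-> y'b']]].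
exists (t *: y + (1 - t) *: y'), (t * b + (1 - t) * b').
split; last exact: econvex_le.
rewrite /vpair !scale_col_mx add_col_mx; congr col_mx.
by apply/matrixP => i j; rewrite !mxE.
Qed.

(** Regular normals to a convex epigraph satisfy a global linear inequality,
    which is closed under limits of normals and base points. *)
Lemma subdifferential_convexE y0 : econvex theta ->
  (forall y, (-oo < theta y)%E) -> edom theta y0 ->
  subdifferential theta y0 = convex_subgradient y0.
Proof.
move=> cvx thetaN dom0; apply/seteqP.
split=> [u [z_ [w_ [zz ww zwN]]] y b yb|u u_sub].
  have [y_ [a_ [zE yy aa]]] := cvg_vpairP zz.
  have [u_ [c_ [wE uu cc]]] := cvg_vpairP ww.
  have le_k k : dot (u_ k) (y - y_ k) + c_ k * (b - a_ k) <= 0.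
    rewrite -dot_vpair -wE -vpairB -zE.
    have [Ez Nz] := zwN k.
    apply: regular_normal_convex Nz _ _ => [z t Az t0 t1|].
      exact: epigraph_convex.
    by exists y, b.
  have lim_k : (fun k => dot (u_ k) (y - y_ k) + c_ k * (b - a_ k)) @ \oo -->
      dot u (y - y0) + -1 * (b - fine (theta y0)).
    apply: cvgD.
      by apply: cvg_dot => //; apply: cvgB => //; exact: cvg_cst.
    by apply: cvgM => //; apply: cvgB => //; exact: cvg_cst.
  have : dot u (y - y0) + -1 * (b - fine (theta y0)) <= 0.
    by apply: cvgr_to_le lim_k _; exact: nearW.
  lra.
apply: regular_normal_limiting.
  by exists y0, (fine (theta y0)); rewrite -edom_fine.
apply: regular_normal_of_support => _ [y [b [-> yb]]].
by rewrite vpairB dot_vpair; have := u_sub _ _ yb; lra.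
Qed.

End ConvexSubgradients.

(** * Regular subgradients of the composition *)

Section ChainRule.
Variables (R : realType) (n m : nat).
Variables (f : 'cV[R]_n -> 'cV[R]_m) (x0 : 'cV[R]_n) (J : 'M[R]_(m, n)).
Variables (theta : 'cV[R]_m -> \bar R).
Hypothesis f_diff : strictly_differentiable_at f x0 J.

(** A subgradient u of theta bounds the increment of theta along f below by
    <u, f x - f x0>, which differs from <J^T u, x - x0> by o(|x - x0|). *)
Lemma regular_subdifferential_chain u : convex_subgradient theta (f x0) u ->
  regular_subdifferential (theta \o f) x0 (J^T *m u).
Proof.
move=> u_sub; apply/regular_normal_coneP => e e0.
have S0 : 0 < 1 + enorm u by rewrite ltr_pwDl ?enorm_ge0.
have [d d0 dJ] := strictly_differentiable_atP f_diff (divr_gt0 e0 S0).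
exists d => // _ [x [a [-> xa]]]; rewrite vpairB dot_vpair => xd.
have xd' : enorm (x - x0) < d by apply: le_lt_trans xd; exact: enorm_le_vpair.
have := dJ x x0 xd'; rewrite subrr enorm0 => /(_ d0) fJ.
have cs : dot (J^T *m u) (x - x0) - dot u (f x - f x0) <=
    enorm u * enorm (f x - f x0 - J *m (x - x0)).
  by rewrite -dot_mulmx -dotBr enormBC cauchy_schwarz.
have fu : enorm u * enorm (f x - f x0 - J *m (x - x0)) <= e * enorm (x - x0).
  have := ler_wpM2l (enorm_ge0 u) fJ; move=> /le_trans; apply.
  rewrite mulrA ler_wpM2r ?enorm_ge0// mulrA ler_pdivrMr//.
  by rewrite mulrC ler_pM2l//; lra.
have ex : e * enorm (x - x0) <=
    e * enorm (vpair (x - x0) (a - fine (theta (f x0)))).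
  by rewrite ler_pM2l//; exact: enorm_le_vpair.
have := u_sub _ _ xa; rewrite /comp in ex *; lra.
Qed.

End ChainRule.

(** * Limiting subgradients of the composition *)

Section LimitingChainRule.
Variables (R : realType) (n m : nat).
Variables (f : 'cV[R]_n -> 'cV[R]_m) (x0 : 'cV[R]_n) (J : 'M[R]_(m, n)).
Variables (theta : 'cV[R]_m -> \bar R) (l kappa : R).
Hypothesis f_diff : strictly_differentiable_at f x0 J.
Hypothesis thetaN : forall y, (-oo < theta y)%E.
Hypothesis theta_dom : edom theta (f x0).
Hypothesis cvx : econvex theta.
Hypothesis l_ge0 : 0 <= l.
Hypothesis theta_lip : lipschitz_around_rel_dom theta (f x0) l.
Hypothesis kappa_ge0 : 0 <= kappa.
Hypothesis msqc_f : msqc theta f x0 kappa.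

Let thetar y := fine (theta y).

Lemma strictly_differentiable_lipschitz : exists L d, [/\ 0 <= L, 0 < d &
  forall x x', enorm (x - x0) < d -> enorm (x' - x0) < d ->
    enorm (f x - f x') <= L * enorm (x - x')].
Proof.
have [K K0 JK] := enorm_mulmx_bounded J.
have [d d0 fJ] := strictly_differentiable_atP f_diff ltr01.
exists (1 + K), d; split=> [||x x' xd x'd]; rewrite ?addr_ge0//.
rewrite -(subrK (J *m (x - x')) (f x - f x')) mulrDl.
by apply: le_trans (enormD _ _) _; rewrite lerD ?fJ.
Qed.

Lemma local_lipschitz_bounds : exists L d r, [/\ 0 <= L, 0 < d,
    forall x x', enorm (x - x0) < d -> enorm (x' - x0) < d ->
      enorm (f x - f x') <= L * enorm (x - x'),
    forall x, enorm (x - x0) < d -> enorm (f x - f x0) < r &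
    forall y y', enorm (y - f x0) < r -> enorm (y' - f x0) < r ->
      edom theta y -> edom theta y' ->
      thetar y - thetar y' <= l * enorm (y - y')].
Proof.
have [L [d [L0 d0 fL]]] := strictly_differentiable_lipschitz.
have [U /nbhs_enormP[r r0 rU] theta_l] := theta_lip.
exists L, (Num.min d (r / (1 + L))), r.
have L1 : 0 < 1 + L by rewrite ltr_pwDl.
split => //.
- by rewrite lt_min d0 divr_gt0.
- by move=> x x'; rewrite !lt_min => /andP[xd _] /andP[x'd _]; exact: fL.
- move=> x; rewrite lt_min ltr_pdivlMr// => /andP[xd xr].
  have := fL x x0 xd; rewrite subrr enorm0 => /(_ d0) /le_lt_trans; apply.
  apply: le_lt_trans xr; rewrite mulrC ler_wpM2l ?enorm_ge0//; lra.
- move=> y y' yr y'r ydom y'dom; apply: le_trans (ler_norm _) _.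
  by apply: theta_l; split => //; exact: rU.
Qed.

(** Moving along the graph of phi, shifted up to the height a of the base point,
    stays in the epigraph. There phi has the increment of the shifted graph, and
    by the Lipschitz bound the epigraph distance is controlled by |z - x|. So
    the base point of the normal may lie above the graph. *)
Lemma regular_normal_epigraph_lipschitz (phi : 'cV[R]_n -> \bar R) x a v c K d :
  (forall z, (-oo < phi z)%E) -> 0 <= K -> 0 < d ->
  (forall z, edom phi z -> enorm (z - x) < d ->
     `|fine (phi z) - fine (phi x)| <= K * enorm (z - x)) ->
  (phi x <= a%:E)%E ->
  regular_normal_cone (epigraph phi) (vpair x a) (vpair v (- c)) ->
  forall e, 0 < e -> exists2 t, 0 < t & forall z,
    edom phi z -> enorm (z - x) < t ->
    dot v (z - x) <= c * (fine (phi z) - fine (phi x)) + e * enorm (z - x).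
Proof.
move=> phiN K0 d0 phiK xa vN e e0.
have K1 : 0 < 1 + K by rewrite ltr_pwDl.
have [t t0 tN] := (regular_normal_coneP _ _ _).1 vN _ (divr_gt0 e0 K1).
exists (Num.min d (t / (1 + K))); first by rewrite lt_min d0 divr_gt0.
move=> z zdom; rewrite lt_min ltr_pdivlMr// => /andP[zd zt].
pose b := fine (phi z) - fine (phi x).
have zE : vpair z (a + b) - vpair x a = vpair (z - x) b.
  by rewrite vpairB addrAC subrr add0r.
have pair_le : enorm (vpair (z - x) b) <= enorm (z - x) * (1 + K).
  by have := enorm_vpair_le (z - x) b; have := phiK z zdom zd; rewrite -/b; lra.
have := tN (vpair z (a + b)); rewrite zE dot_vpair => tz.
have {}tz := tz _ (le_lt_trans pair_le zt).
have : e / (1 + K) * enorm (vpair (z - x) b) <= e * enorm (z - x).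
  by rewrite mulrAC ler_pdivrMr// -mulrA ler_pM2l.
have /tz : epigraph phi (vpair z (a + b)).
  exists z, (a + b); split => //.
  have xE := edom_fine phiN (epi_edom xa).
  by move: xa; rewrite (edom_fine phiN zdom) xE !lee_fin /b /=; lra.
rewrite /b; lra.
Qed.

(** Exact penalization: the inequality for points z of the domain of theta o f
    near x becomes one for unconstrained pairs (x', y). By metric subregularity
    some z in the domain is within (kappa + 1) |f x' - y| of x', and theta (f z)
    exceeds theta y by at most a multiple of |f x' - y|. The constant C is the
    same for all base points x near x0, which lets the base point move later. *)
Lemma exact_penalty M : 0 <= M -> exists C d, [/\ 0 <= C, 0 < d &
  forall x a v c, enorm (x - x0) < d -> (theta (f x) <= a%:E)%E ->
    regular_normal_cone (epigraph (theta \o f)) (vpair x a) (vpair v (- c)) ->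
    enorm v <= M -> 0 <= c -> c <= M ->
  forall e, 0 < e -> exists2 s, 0 < s & forall x' y,
    enorm (x' - x) < s -> enorm (y - f x) < s -> edom theta y ->
    dot v (x' - x) <= c * (thetar y - thetar (f x)) + C * enorm (f x' - y)
                      + e * enorm (x' - x)].
Proof.
move=> M0.
have [L [d [r [L0 d0 fL fr theta_l]]]] := local_lipschitz_bounds.
have [d' d'0 err] := msqc_error_bound kappa_ge0 msqc_f.
pose kappa1 := kappa + 1.
have kappa1_gt0 : 0 < kappa1 by rewrite ltr_wpDl.
exists (M * (l * (1 + L * kappa1)) + M * kappa1 + kappa1), (Num.min d d').
split.
- by rewrite !addr_ge0 ?mulr_ge0 ?addr_ge0 ?mulr_ge0// ltW.
- by rewrite lt_min d0.
move=> x a v c; rewrite lt_min => /andP[xd xd'] xa vN vM c0 cM eps eps0.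
(* errors are absorbed into the constant only when the accuracy is at most 1 *)
pose e := Num.min eps 1.
have e0 : 0 < e by rewrite lt_min eps0/=.
have e1 : e <= 1 by rewrite ge_min lexx orbT.
have ee : e <= eps by rewrite ge_min lexx.
have xdom := epi_edom xa.
have [t t0 graph_le] : exists2 t, 0 < t & forall z,
    edom theta (f z) -> enorm (z - x) < t ->
    dot v (z - x) <= c * (thetar (f z) - thetar (f x)) + e * enorm (z - x).
  have dx : 0 < d - enorm (x - x0) by rewrite subr_gt0.
  apply: regular_normal_epigraph_lipschitz (mulr_ge0 l_ge0 L0) dx _ xa vN _ e0.
    by move=> z; exact: thetaN.
  move=> z zdom zx.
  have zd : enorm (z - x0) < d by have := enorm_triangle x z x0; lra.
  rewrite ler_norml -mulrA; apply/andP; split.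
    have := theta_l _ _ (fr _ xd) (fr _ zd) xdom zdom.
    have := ler_wpM2l l_ge0 (fL _ _ xd zd).
    rewrite (enormBC x z) /thetar /=; lra.
  have := theta_l _ _ (fr _ zd) (fr _ xd) zdom xdom.
  have := ler_wpM2l l_ge0 (fL _ _ zd xd); rewrite /thetar /=; lra.
(* Within B of x, every local bound holds. The point z found from x' satisfies
   |z - x| <= kappa1 |f x' - y| + |x' - x|, hence |z - x| < D q = B as soon as
   x' and y are within q of x and f x. *)
pose B := Num.min (Num.min (d - enorm (x - x0)) (d' - enorm (x - x0)))
                  (Num.min (r - enorm (f x - f x0)) t).
have B0 : 0 < B by rewrite !lt_min !subr_gt0 xd xd' (fr _ xd) t0.
pose D := 1 + kappa1 * (1 + L).
have D1 : 1 <= D by rewrite lerDl mulr_ge0 ?addr_ge0// ltW.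
have D0 : 0 < D by apply: lt_le_trans D1.
have [q q0 qB] : exists2 q, 0 < q & D * q = B.
  by exists (B / D); rewrite ?divr_gt0// mulrC divfK// gt_eqF.
exists q => //.
move=> x' y x's ys ydom.
have s_le : q <= B by rewrite -qB ler_peMl// ltW.
have x'B : enorm (x' - x) < B by apply: lt_le_trans s_le.
have yB : enorm (y - f x) < B by apply: lt_le_trans s_le.
move: (x'B) (yB); rewrite !lt_min => /andP[/andP[x'd x'd'] /andP[_ _]].
move=> /andP[_ /andP[yr _]].
have x'd0 : enorm (x' - x0) < d by have := enorm_triangle x x' x0; lra.
have x'd'0 : enorm (x' - x0) < d' by have := enorm_triangle x x' x0; lra.
have yr0 : enorm (y - f x0) < r by have := enorm_triangle (f x) y (f x0); lra.
have [z zdom x'z] := err x' y x'd'0 ydom.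
set gap := enorm (f x' - y) in x'z *.
have gap0 : 0 <= gap by exact: enorm_ge0.
have fyz : gap <= (1 + L) * q.
  have := enorm_triangle (f x) (f x') y; have := fL _ _ x'd0 xd.
  rewrite (enormBC (f x)); rewrite -/gap.
  have := ler_wpM2l L0 (ltW x's); lra.
have zx : enorm (z - x) < B.
  have := enorm_triangle x' z x; rewrite (enormBC z x').
  have := ler_wpM2l (ltW kappa1_gt0) fyz; rewrite -/kappa1 in x'z.
  rewrite -qB /D; lra.
move: (zx); rewrite !lt_min => /andP[/andP[zd _] /andP[_ zt]].
have zd0 : enorm (z - x0) < d by have := enorm_triangle x z x0; lra.
have gz := graph_le z zdom zt.
have vz : dot v (x' - z) <= M * (kappa1 * gap).
  apply: le_trans (cauchy_schwarz _ _) _.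
  by apply: ler_pM; rewrite ?enorm_ge0.
have thz : thetar (f z) - thetar y <= l * ((1 + L * kappa1) * gap).
  have := theta_l _ _ (fr _ zd0) yr0 zdom ydom; move=> /le_trans; apply.
  apply: ler_wpM2l => //.
  have := enorm_triangle (f x') (f z) y; have := fL _ _ zd0 x'd0.
  rewrite (enormBC z x') -/gap; have := ler_wpM2l L0 x'z; rewrite -/kappa1; lra.
have cthz : c * (thetar (f z) - thetar y) <= M * (l * ((1 + L * kappa1) * gap)).
  apply: le_trans (ler_wpM2l c0 thz) _; apply: ler_wpM2r => //.
  by rewrite !mulr_ge0 ?addr_ge0 ?mulr_ge0// ltW.
have ez : e * enorm (z - x) <= eps * enorm (x' - x) + kappa1 * gap.
  have := ler_wpM2l (ltW e0) (enorm_triangle x' z x).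
  rewrite (enormBC z x').
  have := ler_wpM2l (ltW e0) x'z; have := ler_wpM2r (enorm_ge0 (x' - x)) ee.
  have : e * (kappa1 * gap) <= kappa1 * gap by rewrite ler_piMl ?mulr_ge0// ltW.
  rewrite -/kappa1; lra.
have -> : dot v (x' - x) = dot v (x' - z) + dot v (z - x).
  by rewrite -dotDr addrA subrK.
lra.
Qed.

(** Near x0 strict differentiability replaces f x' by x' |-> f x + J (x' - x) up
    to a small multiple of |x' - x|, even though f need not be differentiable
    at x. The resulting inequality is convex in (h, y), with equality at
    (0, f x), so that it suffices to have it near that point: test it at a small
    step t along the segment and divide by t. *)
Lemma penalized_inequality M : 0 <= M -> exists2 C, 0 <= C &
  forall eta, 0 < eta -> exists2 d, 0 < d &
  forall x a v c, enorm (x - x0) < d -> (theta (f x) <= a%:E)%E ->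
    regular_normal_cone (epigraph (theta \o f)) (vpair x a) (vpair v (- c)) ->
    enorm v <= M -> 0 <= c -> c <= M ->
  forall y b h, (theta y <= b%:E)%E ->
    dot v h <= c * (b - thetar (f x)) + C * enorm (J *m h - (y - f x))
               + eta * enorm h.
Proof.
move=> M0; have [C [d [C0 d0 pen]]] := exact_penalty M0.
exists C => // eta eta0.
have C1 : 0 < 2 * (C + 1) by rewrite mulr_gt0// ltr_wpDl.
have [d' d'0 fJ] := strictly_differentiable_atP f_diff (divr_gt0 eta0 C1).
exists (Num.min d d'); first by rewrite lt_min d0.
move=> x a v c; rewrite lt_min => /andP[xd xd'] xa vN vM c0 cM y b h yb.
have [s s0 pens] := pen x a v c xd xa vN vM c0 cM _ (divr_gt0 eta0 (ltr0n _ 2)).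
pose s' := Num.min s (d' - enorm (x - x0)).
have s'0 : 0 < s' by rewrite lt_min s0 subr_gt0.
have [t [t0 t1]] :=
  small_step s'0 (addr_ge0 (enorm_ge0 h) (enorm_ge0 (y - f x))).
rewrite mulrDr => tS.
have th0 := mulr_ge0 (ltW t0) (enorm_ge0 h).
have ty0 := mulr_ge0 (ltW t0) (enorm_ge0 (y - f x)).
have ths : t * enorm h < s' by lra.
have tys : t * enorm (y - f x) < s' by lra.
move: ths tys; rewrite !lt_min => /andP[ths thd] /andP[tys _].
have xdom := epi_edom xa.
have fxE := edom_fine thetaN xdom.
have fx_le : (theta (f x) <= (thetar (f x))%:E)%E by rewrite fxE.
have yt_le := econvex_le cvx t0 t1 yb fx_le.
have xhE : x + t *: h - x = t *: h by rewrite addrAC subrr add0r.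
have := pens (x + t *: h) (t *: y + (1 - t) *: f x).
rewrite xhE convex_combB !enormZ gtr0_norm// => /(_ ths tys (epi_edom yt_le)).
rewrite dotZr => pent.
have vt : thetar (t *: y + (1 - t) *: f x) - thetar (f x) <=
    t * (b - thetar (f x)).
  have ytE := edom_fine thetaN (epi_edom yt_le).
  by move: yt_le; rewrite ytE lee_fin /thetar /=; lra.
have xhd : enorm (x + t *: h - x0) < d'.
  have := enorm_triangle x (x + t *: h) x0; rewrite xhE enormZ gtr0_norm//; lra.
have := fJ _ _ xhd xd'; rewrite xhE enormZ gtr0_norm// => lin.
have ft : enorm (f (x + t *: h) - (t *: y + (1 - t) *: f x)) <=
    eta / (2 * (C + 1)) * (t * enorm h) + t * enorm (J *m h - (y - f x)).
  apply: le_trans (lerD lin (lexx _)).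
  have -> : t * enorm (J *m h - (y - f x)) = enorm (t *: (J *m h - (y - f x))).
    by rewrite enormZ gtr0_norm.
  apply: le_trans (enormD _ _).
  rewrite -scalemxAr scalerBr -convex_combB addrA subrK opprB.
  by rewrite addrA subrK.
have eC : C * (eta / (2 * (C + 1))) <= eta / 2.
  by rewrite mulrA ler_pdivrMr//; have := mulr_ge0 C0 (ltW eta0); lra.
rewrite -(ler_pM2l t0).
have := ler_wpM2l c0 vt; have := ler_wpM2l C0 ft; have := ler_wpM2r th0 eC; lra.
Qed.

(** Pass to the limit along a sequence of regular normals: their last components
    tend to -1, and C depends neither on the index nor on the error eta. *)
Lemma limiting_penalized_inequality v : subdifferential (theta \o f) x0 v ->
  exists2 C, 0 <= C & forall y b h, (theta y <= b%:E)%E ->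
    dot v h <= b - thetar (f x0) + C * enorm (J *m h - (y - f x0)).
Proof.
move=> [z_ [w_ [zz ww zwN]]].
have [x_ [a_ [zE xx aa]]] := cvg_vpairP zz.
have [v_ [c_ [wE vv cc]]] := cvg_vpairP ww.
have x_epi k : (theta (f (x_ k)) <= (a_ k)%:E)%E.
  have [x [a [+ xa]]] := (zwN k).1; rewrite zE => /eq_col_mx[-> aE].
  by have /matrixP/(_ 0 0) := aE; rewrite !mxE => ->.
(* eventually |v_k| <= |v| + 1 and -c_k <= 2 *)
pose M := enorm v + 2.
have M0 : 0 <= M by rewrite addr_ge0 ?enorm_ge0.
have [C C0 pen] := penalized_inequality M0; exists C => // y b h yb.
have [L [d [r [L0 d0 fL fr theta_l]]]] := local_lipschitz_bounds.
have near_x e : 0 < e -> \forall k \near \oo, enorm (x_ k - x0) < e.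
  by move: e; apply/cvg_enormP.
have fx0 : enorm (x0 - x0) < d by rewrite subrr enorm0.
have f_lim : (fun k => enorm (f (x_ k) - f x0)) @ \oo --> (0 : R).
  apply: (@squeeze_cvgr _ _ _ _ (fun=> 0) (fun k => L * enorm (x_ k - x0))).
  - apply: filterS (near_x _ d0) => k xd.
    by rewrite enorm_ge0 fL.
  - exact: cvg_cst.
  - rewrite -(mulr0 L); apply: cvgM; [exact: cvg_cst|exact: cvg_enorm].
have thetar_lim : (fun k => thetar (f (x_ k))) @ \oo --> thetar (f x0).
  apply/cvgrPdist_lt => e e0; have l1 : 0 < 1 + l by rewrite ltr_pwDl.
  have /cvgrPdist_lt/(_ _ (divr_gt0 e0 l1)) := f_lim.
  apply: filterS2 (near_x _ d0) => k xd.
  rewrite sub0r normrN ger0_norm ?enorm_ge0// ltr_pdivlMr// => le_e.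
  have xdom := epi_edom (x_epi k).
  have le1 := theta_l _ _ (fr _ xd) (fr _ fx0) xdom theta_dom.
  have le2 := theta_l _ _ (fr _ fx0) (fr _ xd) theta_dom xdom.
  rewrite (enormBC (f x0)) in le2.
  have := enorm_ge0 (f (x_ k) - f x0).
  by rewrite ltr_norml; move=> ?; apply/andP; split; lra.
apply/ler_addgt0Pr => e e0.
have S0 : 0 < 1 + enorm h by rewrite ltr_pwDl ?enorm_ge0.
have [d' d'0 pend] := pen _ (divr_gt0 e0 S0).
have dot_lim : (fun k => dot (v_ k) h) @ \oo --> dot v h.
  by apply: cvg_dot => //; exact: cvg_cst.
have rhs_lim : (fun k => - c_ k * (b - thetar (f (x_ k))) +
    C * (enorm (J *m h - (y - f x0)) + enorm (f (x_ k) - f x0)) +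
    e / (1 + enorm h) * enorm h) @ \oo -->
    - -1 * (b - thetar (f x0)) + C * (enorm (J *m h - (y - f x0)) + 0) +
    e / (1 + enorm h) * enorm h.
  apply: cvgD; last exact: cvg_cst.
  apply: cvgD; apply: cvgM.
  - exact: cvgN.
  - by apply: cvgB => //; exact: cvg_cst.
  - exact: cvg_cst.
  - by apply: cvgD => //; exact: cvg_cst.
have le_lim := ler_cvg_to dot_lim rhs_lim.
have eh : e / (1 + enorm h) * enorm h <= e.
  by rewrite mulrAC ler_pdivrMr// ler_pM2l//; lra.
suff : dot v h <= - -1 * (b - thetar (f x0)) +
    C * (enorm (J *m h - (y - f x0)) + 0) + e / (1 + enorm h) * enorm h by lra.
apply: le_lim; near=> k.
have xd' : enorm (x_ k - x0) < d' by near: k; exact: near_x.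
have vM : enorm (v_ k) <= M.
  have v1 : enorm (v_ k - v) < 1 by near: k; exact: (cvg_enormP _ _).1.
  by have := enormD (v_ k - v) v; rewrite subrK /M; lra.
have c1 : `|-1 - c_ k| < 1 by near: k; move/cvgrPdist_lt : cc; apply.
have [c0 cM] : 0 <= - c_ k /\ - c_ k <= M.
  move: c1; rewrite ltr_norml /M => /andP[? ?].
  by have := enorm_ge0 v; split; lra.
have := (zwN k).2; rewrite zE wE -[c_ k]opprK => kN.
have := pend _ _ _ _ xd' (x_epi k) kN vM c0 cM y b h yb.
have yE : J *m h - (y - f (x_ k)) = J *m h - (y - f x0) + (f (x_ k) - f x0).
  by apply/matrixP => i j; rewrite !mxE; ring.
have := enormD (J *m h - (y - f x0)) (f (x_ k) - f x0).
rewrite -yE => /(ler_wpM2l C0); lra.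
Unshelve. all: by end_near. Qed.

(** By the penalized inequality, the infimal convolution of theta - theta (f x0)
    with C |.|, shifted by J h and minimized over h after subtracting <v, h>, is
    nonnegative at 0. A linear minorant u of that convex function is a
    subgradient of theta (take h = 0), and satisfies <v, h> <= <u, J h> for
    all h (take y = f x0), which forces J^T u = v. *)
Lemma subgradient_of_limiting v : subdifferential (theta \o f) x0 v ->
  exists2 u, convex_subgradient theta (f x0) u & J^T *m u = v.
Proof.
move=> /limiting_penalized_inequality[C C0 pen].
have y0E : theta (f x0) = (thetar (f x0))%:E by exact: edom_fine.
pose E z r := exists y b h, (theta y <= b%:E)%E /\
  b - thetar (f x0) + C * enorm (z + J *m h - (y - f x0)) - dot v h <= r.
have [|z|r|u uE] := @linear_minorant R m E.
- move=> z z' r r' t t0 t1 [y [b [h [yb le_r]]]] [y' [b' [h' [y'b' le_r']]]].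
  have s0 : 0 < 1 - t by rewrite subr_gt0.
  exists (t *: y + (1 - t) *: y'), (t * b + (1 - t) * b'),
    (t *: h + (1 - t) *: h').
  split; first exact: econvex_le.
  have pE : t *: z + (1 - t) *: z' + J *m (t *: h + (1 - t) *: h') -
      (t *: y + (1 - t) *: y' - f x0) =
      t *: (z + J *m h - (y - f x0)) + (1 - t) *: (z' + J *m h' - (y' - f x0)).
    rewrite mulmxDr -!scalemxAr; apply/matrixP => i j; rewrite !mxE; ring.
  have := enormD (t *: (z + J *m h - (y - f x0)))
                 ((1 - t) *: (z' + J *m h' - (y' - f x0))).
  rewrite pE !enormZ !gtr0_norm// => /(ler_wpM2l C0).
  have := ler_wpM2l (ltW t0) le_r; have := ler_wpM2l (ltW s0) le_r'.
  rewrite dotDr !dotZr; lra.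
- eexists; exists (f x0), (thetar (f x0)), 0; split; last exact: lexx.
  by rewrite y0E.
- move=> [y [b [h [yb]]]]; rewrite add0r; have := pen y b h yb; lra.
exists u.
  move=> y b yb; apply: uE; exists y, b, 0; split => //.
  by rewrite mulmx0 addr0 subrr enorm0 dot0r mulr0 addr0 subr0.
have dotJ h : dot v h <= dot (J^T *m u) h.
  have := uE (- (J *m h)) (- dot v h).
  rewrite dotNr lerN2 dot_mulmx; apply; exists (f x0), (thetar (f x0)), h.
  by rewrite y0E addNr !subrr enorm0 mulr0 addr0 sub0r.
apply/eqP; rewrite eq_sym -subr_eq0; apply/eqP/dot_eq0/le_anti.
by rewrite dot_ge0 andbT dotBl subr_le0 dotJ.
Qed.

End LimitingChainRule.

Theorem theorem3p6 (R : realType) (n m : nat)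
    (f : 'cV[R]_n -> 'cV[R]_m) (xbar : 'cV[R]_n) (J : 'M[R]_(m, n))
    (theta : 'cV[R]_m -> \bar R) (l kappa : R)
    (f_diff : strictly_differentiable_at f xbar J)
    (theta_gtNy : forall y, (-oo < theta y)%E)
    (theta_dom : edom theta (f xbar))
    (theta_convex : econvex theta)
    (theta_lsc : lsc_around theta (f xbar))
    (l_ge0 : 0 <= l)
    (theta_lip : lipschitz_around_rel_dom theta (f xbar) l)
    (kappa_ge0 : 0 <= kappa)
    (msqc_theta_f : msqc theta f xbar kappa) :
  [/\ lower_regular (theta \o f) xbar,
      subdifferential (theta \o f) xbar
        = regular_subdifferential (theta \o f) xbar &
      regular_subdifferential (theta \o f) xbar
        = [set J^T *m v | v in subdifferential theta (f xbar)]].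
Proof.
have sub_image : subdifferential (theta \o f) xbar `<=`
    [set J^T *m v | v in subdifferential theta (f xbar)].
  move=> v /(subgradient_of_limiting f_diff theta_gtNy theta_dom theta_convex
    l_ge0 theta_lip kappa_ge0 msqc_theta_f)[u u_sub uv].
  by exists u => //; rewrite subdifferential_convexE.
have image_reg : [set J^T *m v | v in subdifferential theta (f xbar)] `<=`
    regular_subdifferential (theta \o f) xbar.
  move=> _ [u + <-]; rewrite subdifferential_convexE// => u_sub.
  exact: regular_subdifferential_chain.
have reg_sub : regular_subdifferential (theta \o f) xbar `<=`
    subdifferential (theta \o f) xbar.
  move=> v; apply: regular_normal_limiting.
  by exists xbar, (fine (theta (f xbar))); rewrite /= -edom_fine.
have sub_reg : subdifferential (theta \o f) xbar
    = regular_subdifferential (theta \o f) xbar.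
  by apply/seteqP; split=> // v /sub_image/image_reg.
split=> //; apply/seteqP; split=> //.
by apply: subset_trans sub_image.
Qed.
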